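(* For every $\varepsilon>0$ there exist real random variables $G$ and $\xi$ (not necessarily independent) on a common probability space such that $\mathrm{Var}(G)=1$, and for all $g$ in the support of $G$ one has $\mathbb E[\xi\mid G=g]=0$ and $\mathrm{Var}(\xi\mid G=g)=\varepsilon^2$, and yet, for $M=G+\xi$, $$\mathbb E_\alpha[G]\to-\infty\qquad\text{as }\alpha\to0^+.$$
   Context: For $\alpha\in(0,1)$, $m_\alpha$ denotes the top-$\alpha$ quantile of $M$, i.e. a real number with $\mathbb P[M\ge m_\alpha]=\alpha$ (the distribution of $M$ is required to be such that this quantile exists). $\mathbb E_\alpha[G]=\mathbb E[G\mid M\ge m_\alpha]$. Conditional expectation and variance given $G=g$ are taken with respect to a specified regular conditional distribution (Markov kernel) of $\xi$ given $G$. *)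

(* Defs.v *)
From HB Require Import structures.
From mathcomp Require Import all_boot all_order all_algebra.
From mathcomp Require Import all_classical all_reals all_analysis.

Set Implicit Arguments.
Unset Strict Implicit.
Unset Printing Implicit Defensive.

Import Order.TTheory GRing.Theory Num.Theory.
Import numFieldNormedType.Exports.

Local Open Scope classical_set_scope.
Local Open Scope ring_scope.

(* The library does not attach a probability structure to the values of a
   Markov kernel, which its expectation and variance operators require. *)
Definition kernel_law d d' (X : measurableType d) (Y : measurableType d')
  (R : realType) (k : R.-pker X ~> Y) (x : X) : set Y -> \bar R := k x.

Section kernel_law_probability.
Context d d' (X : measurableType d) (Y : measurableType d') (R : realType).
Variables (k : R.-pker X ~> Y) (x : X).

HB.instance Definition _ := Measure.copy (kernel_law k x) (k x).

HB.instance Definition _ :=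
  Measure_isProbability.Build _ _ _ (kernel_law k x) (prob_kernel x).

End kernel_law_probability.

Definition regular_cond_distribution d (T : measurableType d) (R : realType)
    (P : probability T R) (G xi : {RV P >-> R}) (k : R.-pker R ~> R) : Prop :=
  forall A B : set R, measurable A -> measurable B ->
    P (G @^-1` A `&` xi @^-1` B) = (\int[distribution P G]_(g in A) k g B)%E.

Definition law_support d (T : measurableType d) (R : realType)
    (P : probability T R) (X : {RV P >-> R}) : set R :=
  [set x | forall U : set R, open U -> U x -> (0 < distribution P X U)%E].

Definition top_event (T : Type) (R : realType) (M : T -> R) (m : R) : set T :=
  [set w | m <= M w].

Definition top_quantile d (T : measurableType d) (R : realType)
    (P : probability T R) (M : T -> R) (alpha m : R) : Prop :=
  P (top_event M m) = alpha%:E.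

Definition cond_expectation_event d (T : measurableType d) (R : realType)
    (P : probability T R) (X : T -> R) (A : set T) : R :=
  (\int[P]_(w in A) X w) / fine (P A).

(* Main.v *)
Require Import Defs.
From HB Require Import structures.
From mathcomp Require Import all_boot all_order all_algebra.
From mathcomp Require Import all_classical all_reals all_analysis.
From mathcomp Require Import measurable_realfun ring lra.

Set Implicit Arguments.
Unset Strict Implicit.
Unset Printing Implicit Defensive.

Import Order.TTheory GRing.Theory Num.Theory.
Import numFieldNormedType.Exports.

Local Open Scope classical_set_scope.
Local Open Scope ring_scope.

(** Let [U1], [U2] be independent and uniform on [[0, 1]] and put
    [G = - s * sqrt (- ln U1)]: thus [G <= 0], [G] is atomless and unbounded
    below, and [s] is chosen to make its variance 1.  Given [G = g], the noise
    [xi] takes two values: [b g = 2 * (|g| + eps)], with a small probability,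
    and [- eps^2 / b g]; the probability is the one for which the mean is 0,
    and then the variance is [eps^2].  When the large value occurs,
    [M = G + xi] equals [2 * eps - G]; otherwise [M < 0].  So for [m >= 0] the
    event [M >= m] forces [G <= 2 * eps - m], whereas it has positive
    probability for every [m], so that the top quantiles tend to infinity.
    They exist because [M] is atomless: each of the two possible values of [M]
    is an injective function of [G]. *)

(** * The uniform distribution on the unit interval *)

Section uniform01.
Context {R : realType}.

Let toR : measurableTypeR R -> R := idfun.

#[local] HB.instance Definition _ :=
  @isMeasurableFun.Build _ _ _ _ toR (@measurable_id _ _ setT).

(* [uniform_prob] lives on [measurableTypeR R], whose measurable structure is a
   different instance from the one carried by [R] itself. *)
Definition uniform01 : probability R R :=
  distribution (uniform_prob (@ltr01 R)) toR.

Lemma uniform01E (A : set R) : measurable A ->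
  uniform01 A = lebesgue_measure (A `&` `[0, 1]).
Proof.
move=> mA; transitivity (uniform_prob (@ltr01 R) A) => //.
rewrite /uniform_prob integral_uniform_pdf.
under eq_integral.
  move=> x; rewrite inE/= in_itv/= => -[_ x01].
  rewrite /uniform_pdf x01 subr0 invr1.
  over.
rewrite integral_cst ?mul1e//.
exact: measurableI.
Qed.

Lemma uniform01_set1 (x : R) : uniform01 [set x] = 0%E.
Proof.
rewrite uniform01E//; apply/eqP; rewrite eq_le measure_ge0 andbT.
rewrite -(lebesgue_measure_set1 x) le_measure ?inE//.
exact: measurableI.
Qed.

Lemma uniform01_itv (b0 b1 : bool) (x y : R) : 0 <= x -> x <= y -> y <= 1 ->
  uniform01 [set` Interval (BSide b0 x) (BSide b1 y)] = (y - x)%:E.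
Proof.
move=> x0 xy y1; rewrite uniform01E// setIidl; last first.
  move=> z /=; rewrite !in_itv/=; move: b0 b1 => [] [] /= /andP[xz zy];
  by apply/andP; split; lra.
rewrite lebesgue_measure_itv/= lte_fin; case: ifPn => //.
(* Without [x < y] the interval formula returns 0, and here that forces [x = y]. *)
by rewrite -leNgt => yx; congr EFin; lra.
Qed.

Lemma uniform01_itvNy (q : R) : 0 <= q -> q <= 1 ->
  uniform01 [set u | u <= q] = q%:E.
Proof.
move=> q0 q1; rewrite -[in RHS](subr0 q).
rewrite -(@uniform01_itv true false 0 q)// !uniform01E//; last first.
  by rewrite (_ : [set _ | _] = `]-oo, q]%classic).
congr lebesgue_measure; apply/seteqP; split => x /=; rewrite !in_itv/=.
  by move=> [-> /andP[-> ->]].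
by move=> [/andP[_ ->] ->].
Qed.

Lemma uniform01_setC : uniform01 (~` `]0, 1[) = 0%E.
Proof.
rewrite probability_setC// uniform01_itv// subr0.
by rewrite -EFinB subrr.
Qed.

End uniform01.

(** * Markov kernels obtained by randomization *)

Section section_kernel.
Context d1 d2 d3 (X : measurableType d1) (Y : measurableType d2)
  (Z : measurableType d3) (R : realType).
Variables (U : probability Y R) (h : {mfun (X * Y)%type >-> Z}).

Let measurable_section (x : X) : measurable_fun [set: Y] (fun y => h (x, y)).
Proof. exact: measurable_fun_pair2. Qed.

(** A named section can carry the measurable-function structure that [distribution] expects. *)
Let section (x : X) (y : Y) := h (x, y).

HB.instance Definition _ x :=
  isMeasurableFun.Build _ _ _ _ (section x) (measurable_section x).

Definition section_kernel (x : X) : {measure set Z -> \bar R} :=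
  distribution U (section x).

Let measurable_section_kernel (A : set Z) : measurable A ->
  measurable_fun [set: X] (section_kernel ^~ A).
Proof.
move=> mA.
have mhA : measurable (h @^-1` A).
  by rewrite -[X in measurable X]setTI; exact: measurable_funP.
apply: (eq_measurable_fun (fun x => U (xsection (h @^-1` A) x))) => [x _|].
  by rewrite xsectionE.
exact: measurable_fun_xsection.
Qed.

HB.instance Definition _ := isKernel.Build _ _ _ _ _
  section_kernel measurable_section_kernel.

Let section_kernel_setT x : section_kernel x [set: Z] = 1%E.
Proof. exact: probability_setT. Qed.

HB.instance Definition _ := Kernel_isProbability.Build _ _ _ _ _
  section_kernel section_kernel_setT.

End section_kernel.

(** The first coordinate determines [G] and the second is independent of it, so freezing [G] at [g]
    leaves [xi] with the law of [h (g, .)] under [U]. Tonelli's theorem makes this precise. *)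
Lemma regular_cond_distribution_section d1 d2 (X : measurableType d1)
    (Y : measurableType d2) (R : realType) (mu : probability X R)
    (U : probability Y R) (phi : {mfun X >-> R})
    (h : {mfun (R * Y)%type >-> R}) (G xi : {RV (mu \x U)%E >-> R}) :
    (forall w, G w = phi w.1) -> (forall w, xi w = h (phi w.1, w.2)) ->
  regular_cond_distribution G xi (section_kernel U h).
Proof.
move=> GE xiE A B mA mB.
have mphiA : measurable (phi @^-1` A).
  by rewrite -[X in measurable X]setTI; exact: measurable_funP.
have mk : measurable_fun [set: R] (section_kernel U h ^~ B).
  exact: measurable_kernel.
rewrite ge0_integral_pushforward//; last first.
  exact: measurable_funTS.
rewrite (_ : G @^-1` A = (phi @^-1` A) `*` [set: Y]); last first.
  by apply/seteqP; split => -[x y] /=; rewrite GE//= => -[].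
(* After Tonelli on the right, both sides are integrals over [x], the product measure on the left
   being the integral of the measures of the sections. The integrands are then compared according to
   whether [phi x] lies in [A]. *)
rewrite integral_mkcond fubini_tonelli1/=; last 2 first.
- apply/(measurable_restrictT _ _).1.
    by apply: measurableX.
  apply: measurable_funTS.
  apply: measurableT_comp => //.
- by move=> w; apply: erestrict_ge0 => ? _; exact: measure_ge0.
apply: eq_integral => x _; rewrite /fubini_F /=.
have [xA|xA] := pselect (A (phi x)).
- transitivity (section_kernel U h (phi x) B).
    congr (U _); apply/seteqP; split => y; rewrite /xsection/= inE/= xiE/=.
      by case.
    by [].
  transitivity (\int[U]_y (cst (section_kernel U h (phi x) B) y))%E.
    by rewrite integral_cst//= [U _ in RHS]probability_setT mule1.
  by apply: eq_integral => y _; rewrite patchE mem_set//= GE.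
- rewrite integral0_eq; last first.
    by move=> y _; rewrite patchE memNset//= => -[].
  rewrite (_ : xsection _ _ = set0) ?measure0//.
  by apply/seteqP; split => y//; rewrite /xsection/= inE/= => -[[]].
Qed.

(** * Integrals of two-valued functions *)

Section two_valued.
Context d (Y : measurableType d) (R : realType) (U : probability Y R).
Variables (p : Y -> bool) (a b : R).
Hypothesis mp : measurable [set y | p y].

Let A := [set y | p y].

Let ifE : (fun y => (if p y then a else b)%:E) =
  (fun y => (a - b)%:E * (\1_A y)%:E + b%:E)%E.
Proof.
apply/funext => y; rewrite -EFinM -EFinD indicE; congr EFin.
case: ifPn => py; [by rewrite mem_set// mulr1 subrK|].
by rewrite memNset ?mulr0 ?add0r//; apply/negP.
Qed.

Let integrable_indicZ :
  U.-integrable setT (fun y => (a - b)%:E * (\1_A y)%:E)%E.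
Proof. by apply: integrableZl => //; exact: integrable_indic. Qed.

Lemma integrable_if : U.-integrable setT (fun y => (if p y then a else b)%:E).
Proof.
by rewrite ifE; apply: integrableD => //; exact: finite_measure_integrable_cst.
Qed.

Lemma integral_if : (\int[U]_y (if p y then a else b)%:E =
  a%:E * U A + b%:E * (1 - U A))%E.
Proof.
rewrite ifE integralD//=; last exact: finite_measure_integrable_cst.
rewrite integralZl//=; last exact: integrable_indic.
rewrite integral_indic// setIT integral_cst//=.
rewrite [X in (_ + _ * X)%E]probability_setT mule1.
rewrite -(fineK (fin_num_measure U _ mp)) -!EFinM -!EFinD.
by congr EFin; ring.
Qed.

End two_valued.

(** Inversion is continuous on the open complement of 0, and on the remaining singleton every
    function is measurable. *)
Lemma measurable_invr (R : realType) : measurable_fun [set: R] (@GRing.inv R).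
Proof.
rewrite -(setvU [set 0 : R]) measurable_funU//; last exact: measurableC.
split; last exact: measurable_fun_set1.
apply: open_continuous_measurable_fun.
  by apply: closed_openC; exact: closed_eq.
by move=> x; rewrite inE/= => /eqP x0; exact: inv_continuous.
Qed.

(** * The two-valued noise and its conditional moments *)

Section noise.
Context {R : realType}.
Variable eps : R.

(* The summand [eps] gives [lower_jump] a slope smaller than 1 on [g <= 0], so
   that [g - lower_jump g] is injective there. *)
Definition upper_jump (g : R) : R := 2 * (`|g| + eps).
(** A centred variable with the two values [b] and [-c] takes [b] with probability [c / (b + c)] and
    has variance [b * c]. Taking [c = eps ^+ 2 / b] makes the variance [eps ^+ 2], and the
    probability becomes [upper_prob]. *)
Definition lower_jump (g : R) : R := eps ^+ 2 / upper_jump g.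
Definition upper_prob (g : R) : R := eps ^+ 2 / (upper_jump g ^+ 2 + eps ^+ 2).

Definition noise (p : R * R) : R :=
  if p.2 <= upper_prob p.1 then upper_jump p.1 else - lower_jump p.1.

Let measurable_upper_jump : measurable_fun [set: R] upper_jump.
Proof.
by apply: measurable_funM => //; apply: measurable_funD => //;
  exact: normr_measurable.
Qed.

Let measurable_lower_jump : measurable_fun [set: R] lower_jump.
Proof.
apply: measurable_funM => //.
by apply: measurableT_comp => //; exact: measurable_invr.
Qed.

Let measurable_upper_prob : measurable_fun [set: R] upper_prob.
Proof.
apply: measurable_funM => //.
apply: measurableT_comp; first exact: measurable_invr.
by apply: measurable_funD => //; exact: measurable_funX.
Qed.

Lemma measurable_noise : measurable_fun [set: R * R] noise.
Proof.
apply: measurable_fun_ifT => /=.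
- apply: measurable_fun_ler => //.
  exact: measurableT_comp.
- exact: measurableT_comp.
- by apply: measurableT_comp => //; exact: measurableT_comp.
Qed.

HB.instance Definition _ :=
  isMeasurableFun.Build _ _ _ _ noise measurable_noise.

Hypothesis eps_gt0 : 0 < eps.

Lemma upper_jump_gt0 g : 0 < upper_jump g.
Proof. by rewrite mulr_gt0// ltr_wpDl. Qed.

Lemma lower_jump_gt0 g : 0 < lower_jump g.
Proof. by rewrite divr_gt0 ?upper_jump_gt0 ?exprn_gt0. Qed.

Let upper_prob_den_gt0 g : 0 < upper_jump g ^+ 2 + eps ^+ 2.
Proof. by rewrite addr_gt0 ?exprn_gt0 ?upper_jump_gt0. Qed.

Lemma upper_prob_gt0 g : 0 < upper_prob g.
Proof. by rewrite divr_gt0 ?exprn_gt0 ?upper_prob_den_gt0. Qed.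

Lemma upper_prob_le1 g : upper_prob g <= 1.
Proof. by rewrite ler_pdivrMr ?upper_prob_den_gt0// mul1r lerDr sqr_ge0. Qed.

(** A general [f] covers both moments: the identity gives the mean and, the mean being 0, the square
    gives the variance. *)
Lemma expectation_section_kernel_noise (f : R -> R) g :
    measurable_fun [set: R] f ->
  ('E_(kernel_law (section_kernel uniform01 noise) g)[f] =
   (f (upper_jump g) * upper_prob g
    + f (- lower_jump g) * (1 - upper_prob g))%:E)%E.
Proof.
move=> mf; rewrite unlock.
have mq : measurable [set u : R | u <= upper_prob g].
  by rewrite (_ : [set _ | _] = `]-oo, upper_prob g]%classic).
have noiseE : ((EFin \o f) \o (fun u => noise (g, u))) = fun u =>
    (if u <= upper_prob g then f (upper_jump g) else f (- lower_jump g))%:E.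
  by apply/funext => u; rewrite /= /noise/=; case: ifP.
transitivity (\int[uniform01]_u
    (((EFin \o f) \o (fun u => noise (g, u))) u))%E.
  apply: integral_pushforward => //.
  - exact/measurable_EFinP.
  - by rewrite preimage_setT noiseE; exact: integrable_if.
rewrite noiseE integral_if//.
by rewrite uniform01_itvNy ?upper_prob_le1 ?ltW ?upper_prob_gt0//.
Qed.

Lemma expectation_noise g :
  ('E_(kernel_law (section_kernel uniform01 noise) g)[idfun : R -> R] = 0)%E.
Proof.
rewrite expectation_section_kernel_noise; last exact: measurable_id.
congr EFin.
rewrite /upper_prob /lower_jump/=.
have := upper_prob_den_gt0 g; have := upper_jump_gt0 g.
move: (upper_jump g) => b b0 d0.
by field; rewrite !gt_eqF.
Qed.

Lemma variance_noise g :
  ('V_(kernel_law (section_kernel uniform01 noise) g)[idfun : R -> R]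
   = (eps ^+ 2)%:E)%E.
Proof.
rewrite /variance unlock expectation_noise/=.
rewrite [X in expectation _ X](_ : _ = fun x : R => x ^+ 2); last first.
  by apply/funext => x; rewrite !fctE/= subr0 expr2.
rewrite expectation_section_kernel_noise; last exact: measurable_funX.
congr EFin.
rewrite /upper_prob /lower_jump/=.
have := upper_prob_den_gt0 g; have := upper_jump_gt0 g.
move: (upper_jump g) => b b0 d0.
by field; rewrite !gt_eqF.
Qed.

End noise.

(** * The transform [sqrt (- ln u)] of a uniform variable *)

Definition sqrt_nln {R : realType} (u : R) : R := Num.sqrt (- ln u).

Section sqrt_nln.
Context {R : realType}.
Implicit Types r u : R.

Lemma sqrt_nln_ge0 u : 0 <= sqrt_nln u.
Proof. exact: sqrtr_ge0. Qed.

Lemma measurable_sqrt_nln : measurable_fun [set: R] (@sqrt_nln R).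
Proof.
apply: measurableT_comp.
  by apply: continuous_measurable_fun; exact: sqrt_continuous.
by apply: measurableT_comp => //; exact: measurable_ln.
Qed.

HB.instance Definition _ :=
  isMeasurableFun.Build _ _ _ _ (@sqrt_nln R) measurable_sqrt_nln.

(** Inside the unit interval both sides amount to [ln u < - r ^+ 2]. Elsewhere both are false: [ln]
    is 0 by convention for [u <= 0], and the square root of a negative number is 0, which settles
    [u >= 1]. *)
Lemma lt_sqrt_nln r u : 0 <= r ->
  (r < sqrt_nln u) = (u \in `]0, expR (- r ^+ 2)[).
Proof.
move=> r0; rewrite in_itv/= /sqrt_nln.
have [u0|u0] := leP u 0; first by rewrite ln0// oppr0 sqrtr0 ltNge r0.
rewrite -[in RHS](lnK u0) ltr_expR ltrNr.
have [b0|b0] := leP (- ln u) 0.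
  by rewrite ler0_sqrtr// !ltNge r0/= (le_trans b0)// sqr_ge0.
by rewrite -(ltr_sqrt _ b0) sqrtr_sqr ger0_norm.
Qed.

Lemma sqrt_nln_inj : {in `]0, 1[ &, injective (@sqrt_nln R)}.
Proof.
move=> u v; rewrite !in_itv/= => /andP[u0 u1] /andP[v0 v1] /eqP.
rewrite eqr_sqrt ?oppr_ge0 ?ln_le0 ?ltW// eqr_opp => /eqP.
exact: ln_inj.
Qed.

(** By injectivity the fibre has at most one point in the open unit interval, and the complement of
    that interval is null. *)
Lemma uniform01_sqrt_nln_set1 r : uniform01 (@sqrt_nln R @^-1` [set r]) = 0%E.
Proof.
have mI : measurable (`]0, 1[ : set R) by [].
have mr : measurable (@sqrt_nln R @^-1` [set r]).
  by rewrite -[X in measurable X]setTI; exact: measurable_sqrt_nln.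
apply/eqP; rewrite eq_le measure_ge0 andbT -[X in uniform01 X]setIT.
rewrite -(setUv `]0, 1[) setIUr.
apply: (le_trans (measureU2 _ _ _)).
- exact: measurableI.
- by apply: measurableI => //; exact: measurableC.
- apply: (@le_trans _ _ (0 + 0)%E); last by rewrite adde0.
  apply: leeD; last first.
    rewrite -uniform01_setC le_measure ?inE//.
    - by apply: measurableI => //; exact: measurableC.
    - exact: measurableC.
  have [[u [ur u01]]|nu] :=
      pselect (exists u, sqrt_nln u = r /\ `]0, 1[%classic u).
    rewrite -(uniform01_set1 u) le_measure ?inE//; first exact: measurableI.
    move=> v [vr v01] /=; apply: sqrt_nln_inj => //.
    by rewrite vr ur.
  rewrite (_ : _ `&` _ = set0) ?measure0//.
  by apply/seteqP; split => // u [ur u01]; apply: nu; exists u.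
Qed.

End sqrt_nln.

(** * Moments of [sqrt (- ln V)] for a uniform [V], and its normalization *)

Section moments.
Context d (T : measurableType d) (R : realType) (P : probability T R).
Variable V : {RV P >-> R}.
Hypothesis VE : forall A : set R, measurable A -> P (V @^-1` A) = uniform01 A.

Let Y : {RV P >-> R} := (@sqrt_nln R \o V : {mfun T >-> R}).

Lemma prob_lt_sqrt_nln r : 0 <= r ->
  P [set w | r < sqrt_nln (V w)] = (expR (- r ^+ 2))%:E.
Proof.
move=> r0; rewrite -[expR _]subr0 -(@uniform01_itv _ false true).
- rewrite -VE//; congr (P _); apply/seteqP; split => w /=;
    by rewrite lt_sqrt_nln.
- by [].
- exact: expR_ge0.
- by rewrite -expR0 ler_expR oppr_le0 sqr_ge0.
Qed.

(** The square is exponential of rate 1, whose tail coincides with its density. Integrating the tail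
    to get the expectation is thus integrating a probability density. *)
Lemma expectation_sqr_sqrt_nln : ('E_P[fun w => (sqrt_nln (V w) ^+ 2)%R] = 1)%E.
Proof.
pose X : {RV P >-> R} := ((Y : {mfun T >-> R}) * (Y : {mfun T >-> R})).
rewrite (_ : (fun w => _) = X); last by apply/funext => w; rewrite expr2.
rewrite (@ge0_expectation_ccdf _ _ _ P X); last by move=> w; exact: sqr_ge0.
rewrite -(@integral_exponential_pdf R 1)// integral_mkcond.
apply: eq_integral => r _; rewrite /exponential_pdf !patchE.
case: ifPn => //; rewrite inE/= in_itv/= andbT => r0.
rewrite /ccdf /distribution /pushforward mul1r mulN1r.
rewrite -[in RHS](sqr_sqrtr r0) -prob_lt_sqrt_nln ?sqrtr_ge0//.
congr (P _); apply/funext => w /=; rewrite in_itv/= andbT.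
rewrite -[in LHS](sqr_sqrtr r0) -expr2.
by rewrite ltr_pXn2r// nnegrE ?sqrtr_ge0 ?sqrt_nln_ge0.
Qed.

Lemma sqrt_nln_Lfun2 : (fun w => sqrt_nln (V w)) \in Lfun P 2%:E.
Proof.
apply/andP; split; rewrite inE/=.
  exact: (@measurable_funPT _ _ _ _ Y).
rewrite /finite_norm unlock/= poweR_lty//.
have := expectation_sqr_sqrt_nln; rewrite unlock.
under eq_integral do rewrite -(ger0_norm (sqrt_nln_ge0 _)) -powR_mulrn//.
by move=> ->; rewrite ltry.
Qed.

Lemma integrable_scale_sqrt_nln (s : R) :
  P.-integrable setT (fun w => (s * sqrt_nln (V w))%:E).
Proof.
have Pfin : P setT \is a fin_num by rewrite fin_num_measure.
under eq_fun do rewrite EFinM.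
apply: integrableZl => //.
exact/Lfun1_integrable/Lfun_subset12/sqrt_nln_Lfun2.
Qed.

(** With zero variance, Chebyshev's inequality would make a deviation of at least 1 from the mean
    [m] a null event, yet the variable exceeds [|m| + 1] with positive probability. *)
Lemma variance_sqrt_nln_gt0 : (0 < 'V_P[fun w => sqrt_nln (V w)])%E.
Proof.
rewrite lt0e variance_ge0 andbT; apply/eqP => V0.
have := @chebyshev _ _ _ P Y 1 ltr01.
rewrite V0 mule0 leNgt => /negP; apply.
set m := fine _.
apply: (@lt_le_trans _ _ (P [set w | `|m| + 1 < sqrt_nln (V w)])).
  by rewrite prob_lt_sqrt_nln ?lte_fin ?expR_gt0// addr_ge0.
apply: le_measure; rewrite ?inE.
- rewrite (_ : [set _ | _] = Y @^-1` `]`|m| + 1, +oo[); last first.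
    by apply/funext => w /=; rewrite in_itv/= andbT.
  by rewrite -[X in measurable X]setTI; exact: measurable_funPT.
- rewrite (_ : [set _ | _] = (fun w => `|Y w - m|) @^-1` `[1, +oo[); last first.
    by apply/funext => w /=; rewrite in_itv/= andbT.
  rewrite -[X in measurable X]setTI.
  apply: (measurableT_comp (@normr_measurable _ _)) => //.
  exact: measurable_funB.
- move=> w /= h; rewrite ler_normr; apply/orP; left.
  have := ler_norm m; lra.
Qed.

Lemma standardized_sqrt_nln : exists2 s : R, 0 < s &
  ('V_P[fun w => (- s * sqrt_nln (V w))%R] = 1)%E.
Proof.
have V2 := sqrt_nln_Lfun2.
set v := fine ('V_P[fun w => sqrt_nln (V w)]%E).
have vE : ('V_P[fun w => sqrt_nln (V w)] = v%:E)%E.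
  by rewrite fineK// variance_fin_num.
have v0 : 0 < v by rewrite -lte_fin -vE variance_sqrt_nln_gt0.
exists (Num.sqrt v)^-1; first by rewrite invr_gt0 sqrtr_gt0.
rewrite (_ : (fun w => _) =
  ((- (Num.sqrt v)^-1) \o* (fun w => sqrt_nln (V w)))); last first.
  by apply/funext => w; rewrite /= mulrC.
rewrite varianceZ// vE sqrrN exprVn sqr_sqrtr ?ltW//.
by rewrite -EFinM mulVf// gt_eqF.
Qed.

End moments.

(** * Existence of top quantiles for atomless laws *)

Section quantiles.
Context d (T : measurableType d) (R : realType) (P : probability T R).

Let opp (X : {RV P >-> R}) : {RV P >-> R} := - (X : {mfun T >-> R}).

Lemma atomless_cdfN (X : {RV P >-> R}) (r : R) :
  (forall x, P (X @^-1` [set x]) = 0%E) -> (cdf (opp X) (- r) = 1 - cdf X r)%E.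
Proof.
move=> X0; rewrite -ccdf_1_cdf.
transitivity (distribution P X `[r, +oo[).
  rewrite /cdf /distribution/= /pushforward; congr (P _).
  apply/funext => w; rewrite /= !in_itv/= andbT.
  by rewrite -[LHS]/(is_true (- X w <= - r)) lerN2.
rewrite (_ : `[r, +oo[%classic = r |` `]r, +oo[%classic); last first.
  by rewrite setU1itv.
rewrite measureU//.
- by rewrite [X in (X + _)%E](X0 r) add0e.
- by apply/seteqP; split => x//= -[->]; rewrite in_itv/= ltxx.
Qed.

(** Right continuity holds for every cdf. Without atoms, reflection turns left continuity at [r]
    into right continuity at [- r] of the cdf of the opposite variable. *)
Lemma atomless_cdf_continuous (X : {RV P >-> R}) :
  (forall x, P (X @^-1` [set x]) = 0%E) -> continuous (fine \o cdf X).
Proof.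
move=> X0 r.
have cdfE s : cdf X s = (fine (cdf X s))%:E by rewrite fineK ?fin_num_measure.
apply/left_right_continuousP; split; last first.
  by apply: fine_cvg; rewrite /= -cdfE; exact: cdf_right_continuous.
apply/cvg_at_leftNP.
apply: fine_cvg; rewrite -cdfE.
have XE s : cdf X (- s) = (1 - cdf (opp X) s)%E.
  have := atomless_cdfN (- s) X0; rewrite opprK => ->.
  by rewrite cdfE -!EFinB; congr EFin; rewrite subKr.
rewrite -[in X in _ --> X](opprK r) XE.
rewrite (eq_cvg _ _ XE).
apply: cvgeB; [|exact: cvg_cst|exact: cdf_right_continuous].
by rewrite fin_num_adde_defr.
Qed.

Lemma atomless_cdf_surj (X : {RV P >-> R}) (alpha : R) :
    (forall x, P (X @^-1` [set x]) = 0%E) -> 0 < alpha < 1 ->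
  exists r, cdf X r = alpha%:E.
Proof.
move=> X0 /andP[a0 a1].
have cdfE s : cdf X s = (fine (cdf X s))%:E by rewrite fineK ?fin_num_measure.
have [a Fa] : exists a, fine (cdf X a) < alpha.
  have /fine_cvg/cvgr_lt/(_ _ a0) := @cvg_cdfNy0 _ _ _ P X.
  exact: filter_ex.
have [b Fb] : exists b, alpha < fine (cdf X b).
  have /fine_cvg/cvgr_gt/(_ _ a1) := @cvg_cdfy1 _ _ _ P X.
  exact: filter_ex.
have ab : a <= b.
  rewrite leNgt; apply/negP => /ltW /(cdf_nondecreasing X).
  by rewrite (cdfE a) (cdfE b) lee_fin leNgt (lt_trans Fa Fb).
have [||r _ <-] := @IVT R (fine \o cdf X) a b alpha ab.
- by apply: continuous_subspaceT; exact: atomless_cdf_continuous.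
- by rewrite ge_min le_max/= (ltW Fa) (ltW Fb) orbT.
- by exists r; rewrite cdfE.
Qed.

(** The event [m <= M] is [- M <= - m], so a top quantile of [M] is the opposite of a point where
    the cdf of [- M] takes the value [alpha]. *)
Lemma atomless_top_quantile (M : {RV P >-> R}) (alpha : R) :
    (forall x, P (M @^-1` [set x]) = 0%E) -> 0 < alpha < 1 ->
  exists m, top_quantile P M alpha m.
Proof.
move=> M0 a01.
have [|r Fr] := @atomless_cdf_surj (opp M) alpha _ a01.
  move=> x; rewrite -[RHS](M0 (- x)); congr (P _).
  apply/seteqP; split => w /=; first by move=> <-; exact/esym/opprK.
  by move=> Mw; rewrite -(opprK x) -Mw.
exists (- r); rewrite /top_quantile -Fr.
congr (P _); apply/funext => w /=.
by rewrite in_itv/= lerNl.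
Qed.

End quantiles.

(** * The sum of signal and noise as a function of the signal *)

Section noise_sum.
Context {R : realType}.
Variable eps : R.
Hypothesis eps_gt0 : 0 < eps.
Implicit Types g m u : R.

Lemma add_upper_jump g : g <= 0 -> g + upper_jump eps g = 2 * eps - g.
Proof. by move=> g0; rewrite /upper_jump ler0_norm//; ring. Qed.

(** Clearing denominators and using [b' - b = 2 * (g - g')] leaves
    [(g - g') * (b * b' - 2 * eps ^+ 2) = 0]. The second factor is positive because [b] and [b'] are
    at least [2 * eps]. *)
Lemma sub_lower_jump_inj :
  {in [pred g | g <= 0] &, injective (fun g => g - lower_jump eps g)}.
Proof.
move=> g g'; rewrite !inE => g0 g'0 /eqP.
rewrite /lower_jump /upper_jump !ler0_norm// => /eqP.
set b := 2 * (- g + eps); set b' := 2 * (- g' + eps) => h.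
have b2 : 2 * eps <= b by rewrite /b; lra.
have b'2 : 2 * eps <= b' by rewrite /b'; lra.
have bb0 : 4 * eps ^+ 2 <= b * b'.
  have -> : 4 * eps ^+ 2 = (2 * eps) * (2 * eps) by ring.
  by apply: ler_pM => //; rewrite mulr_ge0// ltW.
have b0 : 0 < b by rewrite (lt_le_trans _ b2)// mulr_gt0.
have b'0 : 0 < b' by rewrite (lt_le_trans _ b'2)// mulr_gt0.
have : (g - g') * (b * b' - 2 * eps ^+ 2) = 0.
  have -> : (g - g') * (b * b' - 2 * eps ^+ 2)
      = ((g - eps ^+ 2 / b) - (g' - eps ^+ 2 / b')) * (b * b').
    rewrite [RHS](_ : _ =
        (g - g') * (b * b') - eps ^+ 2 * (b' - b)); last first.
      by field; rewrite !gt_eqF.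
    by rewrite /b /b'; ring.
  by rewrite h subrr mul0r.
move/eqP; rewrite mulf_eq0 => /orP[|]; first by rewrite subr_eq0 => /eqP.
have e0 : 0 < eps ^+ 2 by rewrite exprn_gt0.
by rewrite gt_eqF// subr_gt0 (lt_le_trans _ bb0)//; lra.
Qed.

Lemma le_noise_sum g u m : g <= 0 -> 0 <= m -> m <= g + noise eps (g, u) ->
  g <= 2 * eps - m.
Proof.
move=> g0 m0; rewrite /noise/=; case: ifP => _.
  by rewrite add_upper_jump//; lra.
by have := lower_jump_gt0 eps_gt0 g; lra.
Qed.

Lemma noise_sum_ge g u m : g <= 0 -> g <= 2 * eps - m ->
  u <= upper_prob eps g -> m <= g + noise eps (g, u).
Proof. by move=> g0 gm uq; rewrite /noise/= uq add_upper_jump//; lra. Qed.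

(** Each of the two branches is injective in [g <= 0], hence contributes at most one solution; on
    the upper branch it solves [2 * eps - g = m]. *)
Lemma noise_sum_preimage m : exists g1 g2 : R, forall g u, g <= 0 ->
  g + noise eps (g, u) = m -> g = g1 \/ g = g2.
Proof.
have [[g2 g20 g2m]|nog] :=
    pselect (exists2 g, g <= 0 & g - lower_jump eps g = m).
- exists (2 * eps - m), g2 => g u g0; rewrite /noise/=; case: ifP => _.
    by rewrite add_upper_jump// => <-; left; lra.
  by rewrite -g2m => /(sub_lower_jump_inj g0 g20); right.
(* The lower branch misses the level [m], so the second witness is a dummy. *)
- exists (2 * eps - m), 0 => g u g0; rewrite /noise/=; case: ifP => _ gm.
    by left; move: gm; rewrite add_upper_jump//; lra.
  by exfalso; apply: nog; exists g.
Qed.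

Lemma upper_prob_le g g' : g' <= g -> g <= 0 ->
  upper_prob eps g' <= upper_prob eps g.
Proof.
move=> g'g g0; have g'0 := le_trans g'g g0.
have j0 := upper_jump_gt0 eps_gt0 g; have j'0 := upper_jump_gt0 eps_gt0 g'.
have e0 : 0 < eps ^+ 2 by rewrite exprn_gt0.
rewrite /upper_prob ler_pM2l// lef_pV2 ?posrE ?addr_gt0 ?exprn_gt0//.
rewrite lerD2r ler_pXn2r ?nnegrE ?(ltW j0) ?(ltW j'0)//.
by rewrite /upper_jump !ler0_norm//; lra.
Qed.

End noise_sum.

Lemma cond_expectation_event_le d (T : measurableType d) (R : realType)
    (P : probability T R) (X : T -> R) (A : set T) (c : R) :
    measurable A -> (0 < P A)%E -> P.-integrable setT (EFin \o X) ->
    (forall w, A w -> X w <= c) ->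
  cond_expectation_event P X A <= c.
Proof.
move=> mA PA0 iX Xc.
have PAE : P A = (fine (P A))%:E by rewrite fineK ?fin_num_measure.
rewrite /cond_expectation_event ler_pdivrMr; last by rewrite -lte_fin -PAE.
have -> : c * fine (P A) = \int[P]_(w in A) c.
  by rewrite Rintegral_cst.
apply: le_Rintegral => //.
- exact: integrableS iX.
- exact: finite_measure_integrable_cst.
Qed.

HB.instance Definition _ d1 d2 (T1 : measurableType d1)
    (T2 : measurableType d2) :=
  isMeasurableFun.Build _ _ (T1 * T2)%type T1 fst measurable_fst.

(** * The signal and the noise on the product of two uniform spaces *)

Section construction.
Context {R : realType}.
Variables eps s : R.

Let P : probability (R * R)%type R := (@uniform01 R \x @uniform01 R)%E.

Definition scaled (u : R) : R := - s * sqrt_nln u.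

Lemma measurable_scaled : measurable_fun [set: R] scaled.
Proof. by apply: measurable_funM => //; exact: measurable_sqrt_nln. Qed.

HB.instance Definition _ :=
  isMeasurableFun.Build _ _ _ _ scaled measurable_scaled.

Definition signal (w : R * R) : R := scaled w.1.

HB.instance Definition _ := isMeasurableFun.Build _ _ _ _ signal
  (measurableT_comp measurable_scaled measurable_fst).

Definition error (w : R * R) : R := noise eps (scaled w.1, w.2).

Let measurable_error : measurable_fun [set: R * R] error.
Proof.
apply: measurableT_comp; first exact: measurable_noise.
apply: measurable_fun_pair => //.
exact: measurableT_comp measurable_scaled measurable_fst.
Qed.

HB.instance Definition _ :=
  isMeasurableFun.Build _ _ _ _ error measurable_error.

Hypotheses (eps_gt0 : 0 < eps) (s_gt0 : 0 < s).

Lemma scaled_le0 u : scaled u <= 0.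
Proof. by rewrite /scaled mulNr oppr_le0 mulr_ge0 ?sqrt_nln_ge0// ltW. Qed.

Lemma prod_uniform01_fst (A : set R) : measurable A ->
  P (fst @^-1` A) = uniform01 A.
Proof.
move=> mA; rewrite (_ : fst @^-1` A = A `*` setT); last first.
  by apply/seteqP; split => -[x y] //= [].
rewrite [LHS]product_measure1E//.
by rewrite [X in (_ * X)%E]probability_setT mule1.
Qed.

(** A level of the sum confines the signal to two values, and each value of the signal has
    probability 0. *)
Lemma signal_error_atomless m : P ((signal \+ error) @^-1` [set m]) = 0%E.
Proof.
have [g1 [g2 g12]] := noise_sum_preimage eps_gt0 m.
have msc g : measurable (scaled @^-1` [set g]).
  by rewrite -[X in measurable X]setTI; exact: measurable_scaled.
have mM : measurable ((signal \+ error) @^-1` [set m]).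
  by rewrite -[X in measurable X]setTI; exact: measurable_funD.
have P0 g : P (fst @^-1` (scaled @^-1` [set g])) = 0%E.
  rewrite prod_uniform01_fst// -(uniform01_sqrt_nln_set1 (- g / s)).
  congr (uniform01 _); apply/funext => u /=; apply/propext; rewrite /scaled.
  split => [<-|->]; first by field; rewrite gt_eqF.
  by field; rewrite gt_eqF.
have mf g : measurable (@fst R R @^-1` (scaled @^-1` [set g])).
  by rewrite -[X in measurable X]setTI; exact: measurable_fst.
apply/eqP; rewrite eq_le measure_ge0 andbT.
apply: (@le_trans _ _ (P (fst @^-1` (scaled @^-1` [set g1])
    `|` fst @^-1` (scaled @^-1` [set g2])))).
  apply: le_measure; rewrite ?inE//; first exact: measurableU.
  by move=> [u v] /= /g12; apply; exact: scaled_le0.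
apply: (le_trans (measureU2 _ _ _)) => //.
by rewrite -[leRHS]adde0; apply: leeD; rewrite [leLHS]P0.
Qed.

(** The event contains a rectangle of positive probability on which the signal lies in a bounded
    strip to the left of [- |m|] and the large jump occurs. *)
Lemma top_event_signal_error_gt0 m :
  (0 < P (top_event (signal \+ error)%R m))%E.
Proof.
(* The strip is [a < sqrt_nln u <= a + 1]; its lower bound puts the signal below [- |m|]. *)
pose a := `|m| / s.
have a0 : 0 <= a by rewrite divr_ge0// ltW.
(* The large jump is least likely at the far end of the strip, so [q] bounds its probability from
   below on the whole strip. *)
pose q := upper_prob eps (- s * (a + 1)).
have q0 : 0 < q by exact: upper_prob_gt0.
(* These are the points where the decreasing function [sqrt_nln] takes the values [a + 1] and
   [a]. *)
pose lo := expR (- (a + 1) ^+ 2); pose hi := expR (- a ^+ 2).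
have lo0 : 0 < lo by exact: expR_gt0.
have lohi : lo < hi.
  by rewrite ltr_expR ltrN2 ltr_pXn2r ?nnegrE ?addr_ge0//; lra.
have hi1 : hi <= 1 by rewrite -expR0 ler_expR oppr_le0 sqr_ge0.
have mq : measurable [set u | u <= q].
  by rewrite (_ : [set _ | _] = `]-oo, q]%classic).
apply: (@lt_le_trans _ _ (P (`[lo, hi[ `*` [set u | u <= q]))).
  rewrite [ltRHS]product_measure1E//=.
  rewrite uniform01_itv ?(ltW lo0) ?(ltW lohi)//.
  rewrite uniform01_itvNy ?upper_prob_le1 ?(ltW q0)//.
  by rewrite -EFinM lte_fin mulr_gt0// subr_gt0.
apply: le_measure; rewrite ?inE.
- exact: measurableX.
- rewrite /top_event (_ : [set _ | _] = (signal \+ error) @^-1` `[m, +oo[).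
    by rewrite -[X in measurable X]setTI; exact: measurable_funD.
  by apply/funext => w /=; rewrite in_itv/= andbT.
- move=> [u v] [/=]; rewrite in_itv/= => /andP[lou uhi] vq.
  have au : a < sqrt_nln u.
    by rewrite lt_sqrt_nln// in_itv/= uhi (lt_le_trans lo0).
  have ua : sqrt_nln u <= a + 1.
    rewrite leNgt lt_sqrt_nln ?addr_ge0// in_itv/= negb_and -!leNgt.
    by rewrite lou orbT.
  apply: noise_sum_ge => //; first exact: scaled_le0.
  + have : m <= s * sqrt_nln u.
      apply: (le_trans (ler_norm m)).
      by rewrite mulrC -ler_pdivrMr// ltW.
    move=> ms; rewrite /signal/scaled/= mulNr.
    rewrite (@le_trans _ _ (- m)) ?lerN2// lerDr.
    by rewrite mulr_ge0// ltW.
  + apply: (le_trans vq); apply: upper_prob_le => //; last exact: scaled_le0.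
    by rewrite /signal /scaled !mulNr lerN2 ler_pM2l.
Qed.

End construction.

Theorem theorem6 (R : realType) (eps : R) (eps_gt0 : 0 < eps) :
  exists (d : measure_display) (T : measurableType d) (P : probability T R)
         (G xi : {RV P >-> R}) (kappa : R.-pker R ~> R),
    [/\ regular_cond_distribution G xi kappa,
        ('V_P[G] = 1)%E,
        (forall g : R, law_support G g ->
           ('E_(kernel_law kappa g)[idfun : R -> R] = 0)%E /\
           ('V_(kernel_law kappa g)[idfun : R -> R] = (eps ^+ 2)%:E)%E),
        (forall alpha : R, 0 < alpha < 1 ->
           exists m : R, top_quantile P (G \+ xi) alpha m) &
        (forall m : R -> R,
           (forall alpha : R, 0 < alpha < 1 ->
              top_quantile P (G \+ xi) alpha (m alpha)) ->
           cond_expectation_event P G (top_event (G \+ xi) (m alpha))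
             @[alpha --> 0^'+] --> -oo)].
Proof.
pose P : probability (R * R)%type R := (@uniform01 R \x @uniform01 R)%E.
pose U : {RV P >-> R} := (fst : {mfun (R * R)%type >-> R}).
have UE A : measurable A -> P (U @^-1` A) = uniform01 A.
  exact: prod_uniform01_fst.
have [s s_gt0 Vs] := standardized_sqrt_nln UE.
pose G : {RV P >-> R} := (signal s : {mfun (R * R)%type >-> R}).
pose xi : {RV P >-> R} := (error eps s : {mfun (R * R)%type >-> R}).
pose M : {RV P >-> R} :=
  (G : {mfun (R * R)%type >-> R}) + (xi : {mfun (R * R)%type >-> R}).
have mtop m : measurable (top_event (G \+ xi) m).
  rewrite /top_event (_ : [set _ | _] = M @^-1` `[m, +oo[).
    by rewrite -[X in measurable X]setTI; exact: measurable_funPT.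
  by apply/funext => w /=; rewrite in_itv/= andbT.
exists _, _, P, G, xi, (section_kernel uniform01 (noise eps)); split.
- by apply: (@regular_cond_distribution_section _ _ _ _ _ _ _ (scaled s)).
- exact: Vs.
- by move=> g _; split; [exact: expectation_noise|exact: variance_noise].
- move=> alpha a01; apply: (@atomless_top_quantile _ _ _ P M) => // m.
  exact: signal_error_atomless.
- move=> m mE; apply/cvgrNyPle => A.
  (* This makes [2 * eps - K = - |A| <= A], so a quantile above [K] forces the signal below [A] on
     its top event. It also keeps such a quantile nonnegative. *)
  pose K := 2 * eps + `|A|.
  have PK : (0 < P (top_event (G \+ xi)%R K))%E.
    exact: top_event_signal_error_gt0.
  have PKE : P (top_event (G \+ xi)%R K) =
      (fine (P (top_event (G \+ xi)%R K)))%:E.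
    by rewrite fineK ?fin_num_measure.
  have p0 : 0 < fine (P (top_event (G \+ xi)%R K)) by rewrite -lte_fin -PKE.
  near=> alpha.
  have a0 : 0 < alpha by near: alpha; exact: nbhs_right_gt.
  have a1 : alpha < 1 by near: alpha; exact: nbhs_right_lt.
  have ap : alpha < fine (P (top_event (G \+ xi)%R K)).
    by near: alpha; exact: nbhs_right_lt.
  have Pm := mE alpha (introT andP (conj a0 a1)).
  (* If [m alpha <= K], the top event at [m alpha] would contain the one at [K], whose probability
     exceeds [alpha]. *)
  have Km : K < m alpha.
    rewrite ltNge; apply/negP => mK; move: ap.
    rewrite ltNge -lee_fin -PKE -Pm => /negP; apply.
    by apply: le_measure; rewrite ?inE// => w /=; exact: le_trans.
  have Pm0 : (0 < P (top_event (G \+ xi)%R (m alpha)))%E by rewrite Pm lte_fin.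
  have iG : P.-integrable setT (EFin \o G).
    exact: (integrable_scale_sqrt_nln UE).
  apply: (cond_expectation_event_le (mtop _) Pm0 iG) => -[u v] mw.
  have g0 : scaled s u <= 0 by exact: scaled_le0.
  have m0 : 0 <= m alpha.
    by rewrite (le_trans _ (ltW Km))// addr_ge0// mulr_ge0// ltW.
  apply: (le_trans (le_noise_sum eps_gt0 g0 m0 mw)).
  move: Km; rewrite /K => /ltW; have := ler_norm (- A); rewrite normrN.
  by move: (m alpha) `|A| => x y; lra.
Unshelve. all: by end_near.
Qed.
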